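(* For all integers $m\ge 1$ and $n\ge 2$, \[ \sum_{i=0}^{\min\{m,\lfloor n/2\rfloor\}}\prod_{j=1}^i\frac{-(m-j)\binom{n-2j}{2}}{m\binom{n}{2}-(m-j)\binom{n-2j}{2}} =m\prod_{j=1}^{m-1}\frac{mn-\binom{m+1}{2}+\binom{j}{2}}{d_j}, \] where $d_j=\frac{1}{j}\bigl(m\binom{n}{2}-(m-j)\binom{n-2j}{2}\bigr)$, and where on the right-hand side any numerator factor $mn-\binom{m+1}{2}+\binom{j}{2}$ or denominator factor $d_j$ that equals zero is ignored (i.e. replaced by $1$).
   Context: Empty products are equal to $1$. Here $\binom{x}{2}=x(x-1)/2$ for every integer $x$ (including negative $x$). (The left-hand side equals the probability that a uniformly random vertex ordering of the line graph of the $3$-uniform hypergraph $K^{(1,2)}_{m,n}$ — vertex set $V_1\cup V_2$ with $|V_1|=m$, $|V_2|=n$, edges all $3$-sets meeting $V_1$ in one vertex and $V_2$ in two — is successive; this interpretation is not needed for the identity.) *)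

(* Defs.v *)
From mathcomp Require Import all_boot all_order all_algebra.

Set Implicit Arguments.
Unset Strict Implicit.
Unset Printing Implicit Defensive.

Import GRing.Theory Num.Theory.
Local Open Scope ring_scope.

(* The library's 'C(n, 2) is restricted to natural n; here x may be negative. *)
Definition binom2 (x : int) : rat := x%:~R * (x%:~R - 1) / 2%:R.

Definition d (m n j : nat) : rat :=
  j%:R^-1 * (m%:R * binom2 n%:Z
             - (m%:R - j%:R) * binom2 (n%:Z - 2 * j%:Z)).

Definition nonzero_factor (x : rat) : rat := if x == 0 then 1 else x.

(* Main.v *)
Require Import Defs.
From mathcomp Require Import all_boot all_order all_algebra all_field.
From mathcomp Require Import ring zify.
Import Order.TTheory GRing.Theory Num.Theory.
Local Open Scope ring_scope.

Set Implicit Arguments.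
Unset Strict Implicit.
Unset Printing Implicit Defensive.

(** Put G(t) = mn - C(m+1,2) + C(t,2), so that G(1-t) = G(t).  The numerators on
    the right are the G(j) and d_j = G(n+m-2j).  Pairing arguments by the
    reflection t -> 1-t, every factor that can vanish cancels, and the right-hand
    side becomes m * prod_(1 <= j < n) G(m-j) / G(n+m-2j), where all factors are
    positive.

    Over the algebraic numbers write d_j = 2 (j-a) (j-b).  The left-hand side is
    then a 3F2 at 1 in the parameters 1-m, 1-n/2, (3-n)/2; 1-a, 1-b.  It is not
    balanced, but a telescoping identity based on the values of a+b and ab shows
    that it equals b times the balanced series
    3F2(-m, -n/2, (1-n)/2; 1-a, -b; 1), which the Pfaff-Saalschuetz formula
    evaluates.  Terminating that series at floor(n/2) rather than at m keeps all
    denominators nonzero. *)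

(** * Rising factorials and the Pfaff-Saalschuetz formula *)

Definition rising (R : comNzRingType) (x : R) (n : nat) : R :=
  \prod_(0 <= j < n) (x + j%:R).

Lemma rising0 (R : comNzRingType) (x : R) : rising x 0 = 1.
Proof. by rewrite /rising big_geq. Qed.

Lemma risingSr (R : comNzRingType) (x : R) n :
  rising x n.+1 = rising x n * (x + n%:R).
Proof. by rewrite /rising big_nat_recr. Qed.

Lemma risingSl (R : comNzRingType) (x : R) n :
  rising x n.+1 = x * rising (x + 1) n.
Proof.
rewrite /rising big_nat_recl //= addr0; congr (_ * _).
by apply: eq_bigr => i _; rewrite -addrA nat1r.
Qed.

Lemma mul_rising_shift (R : comNzRingType) (x : R) n :
  x * rising (x + 1) n = rising x n * (x + n%:R).
Proof. by rewrite -risingSl risingSr. Qed.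

(** The [k]-th term of 3F2(-N, al, be; c, 1 + al + be - c - N; 1), multiplied by
    [rising c N * rising (c - al - be) N] to clear denominators. *)
Definition saalschutz_term (R : comNzRingType) (al be c : R) (N k : nat) : R :=
  'C(N, k)%:R * (rising al k * rising be k
    * (rising (c + k%:R) (N - k) * rising (c - al - be) (N - k))).

(* The Pfaff-Saalschuetz formula cleared of denominators. The induction rests on
   [(c + k) (x + N - k) + (al + k) (be + k)
      = (c - al + N) (al + k) + (c - al) (x + N - k)] for [x = c - al - be]. *)
Lemma saalschutz (R : comNzRingType) (N : nat) (al be c : R) :
  \sum_(0 <= k < N.+1) saalschutz_term al be c N k
  = rising (c - al) N * rising (c - be) N.
Proof.
elim: N al be c => [|N IH] al be c.
  by rewrite big_nat1 /saalschutz_term !rising0 bin0 !mulr1.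
(* Pascal's rule splits each term in two. Re-pairing the halves by their binomial ['C(N, k)] leaves
   sums with parameters [(al + 1, be, c + 1)] and [(al, be, c + 1)], both covered by [IH]. *)
have step : \sum_(0 <= k < N.+2) saalschutz_term al be c N.+1 k
    = \sum_(0 <= k < N.+1)
        ((c - al + N%:R) * (al * saalschutz_term (al + 1) be (c + 1) N k)
         + (c - al) * ((c - al - be) * saalschutz_term al be (c + 1) N k)).
  pose s k : R := rising al k * rising be k
    * (rising (c + k%:R) (N.+1 - k) * rising (c - al - be) (N.+1 - k)).
  pose p k : R := 'C(N, k)%:R * s k; pose q k : R := 'C(N, k)%:R * s k.+1.
  have -> : \sum_(0 <= k < N.+2) saalschutz_term al be c N.+1 k
      = \sum_(0 <= k < N.+1) (p k + q k).
    rewrite big_split /= big_nat_recl // [X in _ = X + _]big_nat_recl //.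
    rewrite -[RHS]addrA; congr (_ + _).
      by rewrite /saalschutz_term /p !bin0.
    have -> : \sum_(0 <= i < N) p i.+1 = \sum_(0 <= i < N.+1) p i.+1.
      by rewrite [RHS]big_nat_recr // /p /= bin_small // mulr0n mul0r addr0.
    rewrite -big_split /=; apply: eq_bigr => i _.
    by rewrite /saalschutz_term binS natrD mulrDl.
  apply: eq_big_nat => k /andP[_ ltkN].
  rewrite /saalschutz_term /p /q /s -mulrDr subSS subSn //.
  have -> : c + 1 - (al + 1) - be = c - al - be by ring.
  have -> : c + 1 - al - be = c - al - be + 1 by ring.
  have -> : c + 1 + k%:R = c + k%:R + 1 by ring.
  have -> : c + k.+1%:R = c + k%:R + 1 by rewrite -addrA natr1.
  set x := c - al - be.
  have Ea := mul_rising_shift al k.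
  have Ex := mul_rising_shift x (N - k).
  rewrite [rising (c + k%:R) _]risingSl.
  set Y := rising (c + k%:R + 1) _.
  rewrite !risingSr.
  set P := rising al k in Ea *; set Q := rising be k.
  set X := rising x (N - k) in Ex *.
  have Nk : (N - k)%:R = N%:R - k%:R :> R by rewrite natrB.
  transitivity ('C(N, k)%:R * Y * (
     (c - al + N%:R) * (al * rising (al + 1) k) * Q * X
     + (c - al) * P * Q * (x * rising (x + 1) (N - k)))); last by ring.
  by rewrite Ea Ex Nk /x; ring.
rewrite step big_split /= -!big_distrr /= !IH.
have -> : c + 1 - (al + 1) = c - al by ring.
have -> : c + 1 - al = c - al + 1 by ring.
have -> : c + 1 - be = c - be + 1 by ring.
rewrite (risingSl (c - be)).
transitivity (rising (c - be + 1) N * (al * (rising (c - al) N * (c - al + N%:R))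
   + (c - al - be) * ((c - al) * rising (c - al + 1) N))); first by ring.
by rewrite mul_rising_shift -risingSr; ring.
Qed.

Lemma prod_even_odd (R : comNzRingType) (w : nat -> R) (p : nat) :
  \prod_(0 <= s < p) w s
  = \prod_(0 <= j < uphalf p) w j.*2 * \prod_(0 <= j < p./2) w j.*2.+1.
Proof.
elim: p => [|p IH]; first by rewrite !big_geq // mulr1.
rewrite big_nat_recr //= IH uphalf_half.
have := odd_double_half p; case: (odd p) => /= Ep.
  rewrite add1n big_nat_recr //= [in w p]( _ : p = p./2.*2.+1); last by lia.
  by rewrite !big_nat_recr //=; ring.
rewrite add0n big_nat_recr //= [in w p]( _ : p = p./2.*2); last by lia.
by ring.
Qed.

(** * The left-hand series and its balanced companion *)

(** At [x = j] this is half the numerator of the [j]-th factor on the left-hand side. *)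
Definition cubic (F : numFieldType) (M n x : F) : F :=
  (x - M) * (x - n / 2) * (x - (n - 1) / 2).

Definition sum_term (F : numFieldType) (M n a b : F) (i : nat) : F :=
  \prod_(0 <= j < i)
    (cubic M n j.+1%:R / (j.+1%:R * (j.+1%:R - a) * (j.+1%:R - b))).

Definition balanced_term (F : numFieldType) (M n a b : F) (i : nat) : F :=
  \prod_(0 <= j < i)
    (cubic M n j%:R / (j.+1%:R * (j.+1%:R - a) * (j%:R - b))).

(** Both sides have the numerators [cubic 0], ..., [cubic i]. The denominators differ only by the
    first factor [- b] and by the last [i.+1 * (i.+1 - a)]. *)
Lemma sum_term_balanced (F : numFieldType) (M n a b : F) (i : nat) :
  (forall j, (j <= i)%N -> j.+1%:R - a != 0) ->
  (forall j, (j <= i)%N -> j%:R - b != 0) ->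
  cubic M n 0 * sum_term M n a b i
  = - b * (i.+1%:R * (i.+1%:R - a)) * balanced_term M n a b i.+1.
Proof.
elim: i => [|i IH] ha hb; rewrite /sum_term /balanced_term.
  have := ha 0%N isT; have := hb 0%N isT; rewrite sub0r => h1 h2.
  rewrite big_geq // big_nat1; field.
  by rewrite h2 -oppr_eq0 h1.
rewrite big_nat_recr //= mulrA -/(sum_term M n a b i) IH; first last.
- by move=> j hj; apply: hb; lia.
- by move=> j hj; apply: ha; lia.
rewrite [in RHS]big_nat_recr //= -/(balanced_term M n a b i.+1).
have h1 := ha i (leqnSn i); have h2 := ha i.+1 (leqnn _).
have h3 := hb i.+1 (leqnn _).
have n1 : i.+1%:R != 0 :> F by rewrite pnatr_eq0.
have n2 : i.+2%:R != 0 :> F by rewrite pnatr_eq0.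
set x := i.+1%:R in h1 h3 n1 *; set y := i.+2%:R in h2 n2 *.
by clearbody x y; field; rewrite n1 n2 h1 h2 h3.
Qed.

(* [cubic x - x (x - a) (x - 1 - b) = x (x - a) + cubic 0] is what the two
   relations between [a], [b], [M] and [n] buy. *)
Lemma sum_term_telescope (F : numFieldType) (M n a b : F) (L : nat) :
  a + b = M + n - 1 / 2 ->
  a * b = n * (n - 1) / 4 + M * (n - 1 / 2) ->
  (forall j, (j < L)%N -> j.+1%:R - a != 0) ->
  (forall j, (j < L)%N -> j%:R - b != 0) ->
  cubic M n 0 * (b * \sum_(0 <= i < L.+1) balanced_term M n a b i
                 - \sum_(0 <= i < L) sum_term M n a b i)
  = b * (cubic M n L%:R * balanced_term M n a b L).
Proof.
move=> hs hp; elim: L => [|L IH] ha hb.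
  rewrite big_nat1 [\sum_(_ <= _ < _) sum_term _ _ _ _ _]big_geq // subr0.
  by rewrite mulrCA.
have {}IH := IH (fun j hj => ha j (ltnW hj)) (fun j hj => hb j (ltnW hj)).
rewrite big_nat_recr // [in X in _ - X]big_nat_recr //=.
have hT := sum_term_balanced M n ha hb.
have hV : cubic M n L%:R * balanced_term M n a b L
    = L.+1%:R * (L.+1%:R - a) * (L%:R - b) * balanced_term M n a b L.+1.
  rewrite /balanced_term big_nat_recr //=.
  have h1 := ha L (ltnSn L); have h2 := hb L (ltnSn L).
  have n1 : L.+1%:R != 0 :> F by rewrite pnatr_eq0.
  by set x := L.+1%:R in h1 n1 *; clearbody x; field; rewrite n1 h1 h2.
rewrite hV in IH.
set T := sum_term M n a b L in hT *.
set V := balanced_term M n a b L.+1 in hT IH *.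
set A := \sum_(_ <= _ < _) balanced_term _ _ _ _ _ in IH *.
set B := \sum_(_ <= _ < _) sum_term _ _ _ _ _ in IH *.
(* By [hs] and [hp], [a + b] and [a * b] are the first two elementary symmetric functions of the
   roots [M], [n / 2], [(n - 1) / 2]. *)
have hc x : cubic M n x = x ^+ 3 - (a + b) * x ^+ 2 + a * b * x + cubic M n 0.
  by rewrite hs hp /cubic; field.
transitivity (cubic M n 0 * (b * A - B) + b * (cubic M n 0 * V)
              - cubic M n 0 * T); first by ring.
by rewrite IH hT (hc L.+1%:R) -natr1; ring.
Qed.

(** Both sides have the same ratio of consecutive terms. With [n = N - be + 1 / 2], the pair [N],
    [- be] is [n / 2], [(n - 1) / 2] in either order, so both parities of the original [n] are
    covered. *)
Lemma balanced_term_saalschutz (F : numFieldType) (M a b be : F) (N i : nat) :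
  let n := N%:R - be + 1 / 2 in
  a + b = M + n - 1 / 2 ->
  (forall x, cubic M n x = (x - M) * (x - N%:R) * (x + be)) ->
  (forall j, (j < N)%N -> j.+1%:R - a != 0) ->
  (forall j, (j < N)%N -> j%:R - b != 0) ->
  (i <= N)%N ->
  balanced_term M n a b i * (rising (1 - a) N * rising (b + 1 - N%:R) N)
  = saalschutz_term (- M) be (1 - a) N i.
Proof.
move=> n hs hc ha hb; rewrite /saalschutz_term.
(* The value of [a + b] is exactly the balancing condition: it makes the second lower parameter
   [- b]. *)
have -> : 1 - a - - M - be = b + 1 - N%:R.
  have -> : b = M + n - 1 / 2 - a by rewrite -hs; ring.
  by rewrite /n; field.
elim: i => [|i IH] hi.
  by rewrite /balanced_term big_geq // !rising0 bin0 subn0 addr0 !mul1r.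
rewrite /balanced_term big_nat_recr //= -/(balanced_term M n a b i).
rewrite mulrAC IH; last exact: ltnW.
have hNi : (N - i = (N - i.+1).+1)%N by lia.
rewrite hNi [rising (1 - a + _) _.+1]risingSl !risingSr.
have -> : 1 - a + i%:R + 1 = 1 - a + i.+1%:R by rewrite -natr1; ring.
have -> : b + 1 - N%:R + (N - i.+1)%:R = b - i%:R.
  by rewrite natrB // -natr1; ring.
have hbin : 'C(N, i.+1)%:R * i.+1%:R = 'C(N, i)%:R * (N%:R - i%:R) :> F.
  by rewrite -natrB ?(ltnW hi) // -!natrM mulnC mul_bin_left mulnC.
have h1 := ha i hi; have h2 := hb i hi.
have n1 : i.+1%:R != 0 :> F by rewrite pnatr_eq0.
have -> : 'C(N, i.+1)%:R = 'C(N, i)%:R * (N%:R - i%:R) / i.+1%:R :> F.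
  by rewrite -hbin mulfK.
have -> : 1 - a + i%:R = i.+1%:R - a by rewrite -natr1; ring.
rewrite hc; set x := i.+1%:R in h1 n1 *.
by clearbody x; field; rewrite n1 h1 h2.
Qed.

(** * Closed form of the series in terms of [a] and [b] *)

Lemma rising_rev (R : comNzRingType) (x : R) (n : nat) :
  rising x n = \prod_(0 <= j < n) (x + n%:R - 1 - j%:R).
Proof.
rewrite /rising big_nat_rev /=; apply: eq_big_nat => j /andP[_ hj].
by rewrite add0n natrB // -natr1; ring.
Qed.

Lemma prod_nat_rev_shift (R : comNzRingType) (f : nat -> R) (p n : nat) :
  \prod_(p <= j < n) f j = \prod_(0 <= j < n - p) f (n - j.+1)%N.
Proof.
rewrite -{1}(add0n p) big_addn big_nat_rev; apply: eq_big_nat => j hj.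
by congr f; lia.
Qed.

Lemma sum_term_closed_form (F : numFieldType) (M a b : F) (n : nat) :
  (2 <= n)%N -> M != 0 ->
  a + b = M + n%:R - 1 / 2 ->
  a * b = n%:R * (n%:R - 1) / 4 + M * (n%:R - 1 / 2) ->
  (forall j, (j < n)%N -> (j%:R - a) * (j%:R - b) != 0) ->
  (\sum_(0 <= i < n./2) sum_term M n%:R a b i)
    * \prod_(1 <= j < n) (2 * (j%:R - a) * (j%:R - b))
  = M * \prod_(1 <= j < n) ((2 * a - n%:R - j%:R) * (2 * b - n%:R - j%:R) / 2).
Proof.
move=> hn M0 hs hp hD; set K := n./2.
have hK : (n = K.*2 \/ n = K.*2.+1)%N.
  by have := odd_double_half n; rewrite -/K; case: odd => /= <-; [right|left].
have ltKn : (K < n)%N by lia.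
have ha j : (j < K)%N -> j.+1%:R - a != 0.
  move=> hj; have hj' : (j.+1 < n)%N by lia.
  by have := hD _ hj'; rewrite mulf_eq0 negb_or => /andP[].
have hb j : (j < K)%N -> j%:R - b != 0.
  move=> hj; have hj' : (j < n)%N by lia.
  by have := hD _ hj'; rewrite mulf_eq0 negb_or => /andP[].
(* [- be] is whichever of [n / 2], [(n - 1) / 2] is not the integer [K]. *)
pose be : F := K%:R - n%:R + 1 / 2.
have nE : n%:R = K%:R - be + 1 / 2 by rewrite /be; field.
have hc x : cubic M n%:R x = (x - M) * (x - K%:R) * (x + be).
  rewrite /be /cubic; case: hK => ->; rewrite ?doubleK ?uphalf_double -?natr1.
    by rewrite -addnn natrD; field.
  by rewrite -addnn natrD; field.
(* The boundary term of the telescoping vanishes because [K] is a root of [cubic], while [cubic 0]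
   is nonzero and cancels. *)
have S_eq : \sum_(0 <= i < K) sum_term M n%:R a b i
    = b * \sum_(0 <= i < K.+1) balanced_term M n%:R a b i.
  have /eqP := sum_term_telescope hs hp ha hb.
  rewrite (hc K%:R) subrr mulr0 !mul0r mulr0 mulf_eq0 subr_eq0.
  case/orP=> [|/eqP //].
  have n0 : n%:R != 0 :> F by rewrite pnatr_eq0; lia.
  have n1 : n%:R - 1 != 0 :> F by rewrite subr_eq0 pnatr_eq1; lia.
  rewrite /cubic !sub0r !mulf_eq0 !oppr_eq0 !mulf_eq0 (negPf M0) (negPf n0).
  by rewrite (negPf n1) invr_eq0 pnatr_eq0.
have sumV : (\sum_(0 <= i < K.+1) balanced_term M n%:R a b i)
      * (rising (1 - a) K * rising (b + 1 - K%:R) K)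
    = rising (1 - a + M) K * rising (1 - a - be) K.
  rewrite -[M in rising (1 - a + M)]opprK -saalschutz big_distrl /=.
  apply: eq_big_nat => i /andP[_ hi].
  rewrite nE; apply: balanced_term_saalschutz => //; rewrite -?nE //.
have E1 : \prod_(1 <= j < n) (j%:R - a)
    = rising (1 - a) K * \prod_(K.+1 <= j < n) (j%:R - a).
  rewrite (@big_cat_nat _ _ _ K.+1) //=; congr (_ * _).
  rewrite big_add1 /rising; apply: eq_bigr => j _.
  by rewrite -natr1; ring.
have E2 : b * \prod_(1 <= j < n) (b - j%:R)
    = rising (b + 1 - K%:R) K * \prod_(K <= j < n) (b - j%:R).
  have -> : b * \prod_(1 <= j < n) (b - j%:R) = \prod_(0 <= j < n) (b - j%:R).
    by rewrite [RHS]big_ltn ?subr0 //; lia.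
  rewrite (@big_cat_nat _ _ _ K) //= 1?ltnW //; congr (_ * _).
  by rewrite rising_rev; apply: eq_bigr => j _; ring.
(* The rising factorial supplies the half-integral shifts of [- a] and the remaining product the
   integral ones; interleaved, they form one progression of step 1/2. [E4] does the same for [b]. *)
have E3 : rising (1 - a - be) K * \prod_(K.+1 <= j < n) (j%:R - a)
    = \prod_(1 <= j < n) ((n%:R + j%:R) / 2 - a).
  rewrite [RHS]prod_nat_rev_shift prod_even_odd rising_rev.
  rewrite (prod_nat_rev_shift _ K.+1).
  have -> : uphalf (n - 1) = K by rewrite uphalfE; congr half; lia.
  have -> : (n - 1)./2 = (n - K.+1)%N by lia.
  congr (_ * _); apply: eq_big_nat => j /andP[_ hj].
    by rewrite natrB -?natr1 -?addnn ?natrD /be; [field|lia].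
  by rewrite !natrB -?natr1 -?addnn ?natrD; [field|lia|lia].
have E4 : rising (1 - a + M) K * \prod_(K <= j < n) (b - j%:R)
    = \prod_(0 <= j < n) (b - (n%:R - 1 + j%:R) / 2).
  rewrite [RHS]prod_nat_rev_shift subn0 prod_even_odd.
  rewrite (prod_nat_rev_shift _ K) mulrC.
  have -> : uphalf n = (n - K)%N by rewrite uphalf_half; lia.
  congr (_ * _); apply: eq_big_nat => j /andP[_ hj].
    by rewrite !natrB -?natr1 -?addnn ?natrD; [field|lia|lia].
  have -> : M = a + b - n%:R + 1 / 2 by rewrite hs; ring.
  by rewrite !natrB -?natr1 -?addnn ?natrD; [field|lia].
have E5 : \prod_(0 <= j < n) (b - (n%:R - 1 + j%:R) / 2)
    = M * \prod_(1 <= j < n) ((2 * b - n%:R - j%:R) / 2).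
  pose f j : F := b - (n%:R - 1 + j%:R) / 2.
  have -> : \prod_(1 <= j < n) ((2 * b - n%:R - j%:R) / 2)
      = \prod_(2 <= j < n.+1) f j.
    by rewrite [RHS]big_add1 /=; apply: eq_bigr => j _; rewrite /f -natr1; field.
  (* This says that [b] is a root of [t ^ 2 - (a + b) t + a b]. Trading [f 0], [f 1] for [f n] is
     where the outer factor [M] arises. *)
  have f01 : f 0%N * f 1%N = M * f n.
    have -> : M * f n = M * b - M * (n%:R - 1 / 2) by rewrite /f; field.
    have -> : M * (n%:R - 1 / 2) = a * b - n%:R * (n%:R - 1) / 4.
      by rewrite hp; ring.
    have -> : M = a + b - n%:R + 1 / 2 by rewrite hs; ring.
    by rewrite /f; field.
  rewrite -/(\prod_(0 <= j < n) f j) big_ltn; last by lia.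
  by rewrite big_ltn // [in RHS]big_nat_recr //= !mulrA f01 mulrAC.
have -> : \prod_(1 <= j < n) (2 * (j%:R - a) * (j%:R - b))
    = \prod_(1 <= j < n) (- 2 : F)
      * (\prod_(1 <= j < n) (j%:R - a) * \prod_(1 <= j < n) (b - j%:R)).
  by rewrite -!big_split; apply: eq_bigr => j _ /=; ring.
have -> : \prod_(1 <= j < n) ((2 * a - n%:R - j%:R) * (2 * b - n%:R - j%:R) / 2)
    = \prod_(1 <= j < n) (- 2 : F) * \prod_(1 <= j < n) ((n%:R + j%:R) / 2 - a)
      * \prod_(1 <= j < n) ((2 * b - n%:R - j%:R) / 2).
  by rewrite -!big_split; apply: eq_bigr => j _ /=; field.
rewrite [RHS]mulrCA -E5 -E4 -E3 S_eq E1.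
set V := \sum_(_ <= _ < _) _ in sumV *.
set Q := \prod_(1 <= j < n) (b - j%:R) in E2 *.
set P := \prod_(K.+1 <= j < n) _.
set C2 := \prod_(_ <= _ < _) (- 2).
transitivity (C2 * (V * (rising (1 - a) K) * P * (b * Q))); first by ring.
set W := \prod_(K <= j < n) _ in E2 *.
transitivity (C2 * (V * (rising (1 - a) K * rising (b + 1 - K%:R) K) * P * W)).
  by rewrite E2; ring.
by rewrite sumV; ring.
Qed.

(** * Products invariant under the reflection t -> 1 - t *)

Lemma prod_nat_shift (R : comNzRingType) (f : nat -> R) (p n : nat) :
  \prod_(p <= j < n) f j = \prod_(0 <= j < n - p) f (j + p)%N.
Proof. by rewrite -{1}(add0n p) big_addn. Qed.

Lemma prod_reflect (R : comNzRingType) (g : int -> R) (p : nat) :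
  (forall t, g (1 - t) = g t) ->
  \prod_(0 <= i < p) g (p%:Z - 2 * i%:Z) = \prod_(0 <= i < p) g i.+1%:Z.
Proof.
(* The induction advances by two, hence the pair [p], [p.+1]: passing from [p] to [p.+2] adds the
   arguments [p.+2] and [- p], and the latter reflects to [p.+1]. *)
move=> hg; suff : \prod_(0 <= i < p) g (p%:Z - 2 * i%:Z)
      = \prod_(0 <= i < p) g i.+1%:Z
    /\ \prod_(0 <= i < p.+1) g (p.+1%:Z - 2 * i%:Z)
      = \prod_(0 <= i < p.+1) g i.+1%:Z by case.
elim: p => [|p [IH1 IH2]]; first by rewrite !big_nat1; split; rewrite ?big_geq.
split=> //; rewrite big_nat_recl // big_nat_recr //=.
have -> : \prod_(0 <= i < p) g (p.+2%:Z - 2 * i.+1%:Z)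
    = \prod_(0 <= i < p) g (p%:Z - 2 * i%:Z).
  by apply: eq_bigr => i _; congr g; lia.
rewrite IH1 [RHS]big_nat_recr // [in RHS]big_nat_recr //=.
have -> : p.+2%:Z - 2 * p.+1%:Z = 1 - p.+1%:Z by lia.
by rewrite hg subr0 mulrC.
Qed.

(** After reversing the first product, the factors below the smaller of [m] and [n] agree on both
    sides. The rest, of length |n - m|, is an instance of [prod_reflect]. *)
Lemma prod_reflect_exchange (R : comNzRingType) (g : int -> R) (m n : nat) :
  (0 < m)%N -> (0 < n)%N ->
  (forall t, g (1 - t) = g t) ->
  \prod_(1 <= j < m) g j%:Z * \prod_(1 <= j < n) g (n%:Z + m%:Z - 2 * j%:Z)
  = \prod_(1 <= j < m) g (n%:Z + m%:Z - 2 * j%:Z)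
    * \prod_(1 <= j < n) g (m%:Z - j%:Z).
Proof.
move=> m0 n0 hg; have -> : \prod_(1 <= j < m) g j%:Z
    = \prod_(1 <= j < m) g (m%:Z - j%:Z).
  by rewrite big_nat_rev; apply: eq_big_nat => j hj; congr g; lia.
have [le_mn|/ltnW le_nm] := leqP m n.
  rewrite (@big_cat_nat _ _ _ m 1 n _ _ m0 le_mn) /=.
  rewrite [X in _ = _ * X](@big_cat_nat _ _ _ m 1 n _ _ m0 le_mn) /=.
  rewrite [RHS]mulrCA; congr (_ * (_ * _)).
  rewrite ![\prod_(m <= _ < n) _]prod_nat_shift.
  transitivity (\prod_(0 <= i < n - m) g ((n - m)%:Z - 2 * i%:Z)).
    by apply: eq_bigr => i _; congr g; lia.
  rewrite prod_reflect //; apply: eq_bigr => i _.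
  by rewrite -hg; congr g; lia.
rewrite (@big_cat_nat _ _ _ n 1 m _ _ n0 le_nm) /=.
rewrite [X in _ = X * _](@big_cat_nat _ _ _ n 1 m _ _ n0 le_nm) /=.
rewrite [RHS]mulrC -[LHS]mulrA; congr (_ * _); rewrite [RHS]mulrC; congr (_ * _).
rewrite ![\prod_(n <= _ < m) _]prod_nat_shift.
transitivity (\prod_(0 <= i < m - n) g ((m - n)%:Z - 2 * i%:Z)).
  rewrite prod_reflect // big_nat_rev; apply: eq_big_nat => i hi.
  by congr g; lia.
by apply: eq_bigr => i _; congr g; lia.
Qed.

(** * The quadratic G and the right-hand side *)

Definition quad (m n : nat) (t : int) : rat :=
  m%:R * n%:R - binom2 m.+1%:Z + binom2 t.

Lemma quad_reflect m n t : quad m n (1 - t) = quad m n t.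
Proof. by rewrite /quad /binom2 intrB; field. Qed.

Lemma denomE m n j :
  m%:R * binom2 n%:Z - (m%:R - j%:R) * binom2 (n%:Z - 2 * j%:Z)
  = j%:R * quad m n (n%:Z + m%:Z - 2 * j%:Z).
Proof.
by rewrite /quad /binom2 -natr1 !intrD !intrN !intrM -!pmulrn; field.
Qed.

Lemma d_quad m n j : (0 < j)%N ->
  d m n j = quad m n (n%:Z + m%:Z - 2 * j%:Z).
Proof. by move=> j0; rewrite /d denomE mulKf // pnatr_eq0 -lt0n. Qed.

Lemma binom2_ge0 t : 0 <= binom2 t.
Proof.
rewrite /binom2 divr_ge0 // -[1]/(1%:~R) -intrB -intrM ler0z.
by nia.
Qed.

(** The value equals [m * (2 * n - 2 * j - 1)], which is positive for [j < n], plus a nonnegative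
    [binom2]. *)
Lemma quad_denom_gt0 m n j : (0 < m)%N -> (j < n)%N ->
  0 < quad m n (n%:Z + m%:Z - 2 * j%:Z).
Proof.
move=> m0 jn.
have -> : quad m n (n%:Z + m%:Z - 2 * j%:Z)
    = (m * (2 * n - 2 * j - 1))%:R + binom2 (n%:Z - 2 * j%:Z).
  have -> : (m * (2 * n - 2 * j - 1))%:R = m%:R * (2 * n%:R - 2 * j%:R - 1) :> rat.
    by rewrite natrM !natrB ?natrM //; lia.
  by rewrite /quad /binom2 -natr1 !intrD !intrN !intrM -!pmulrn; field.
by rewrite ltr_wpDr ?binom2_ge0 // ltr0n; nia.
Qed.

Lemma quad_num_gt0 m n j : (0 < m)%N -> (0 < j < n)%N ->
  0 < quad m n (m%:Z - j%:Z).
Proof.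
move=> m0 /andP[j0 jn].
have -> : quad m n (m%:Z - j%:Z)
    = (m * (n - 1 - j))%:R + j%:R * j.+1%:R / 2.
  have -> : (m * (n - 1 - j))%:R = m%:R * (n%:R - 1 - j%:R) :> rat.
    by rewrite natrM !natrB //; lia.
  by rewrite /quad /binom2 -!natr1 !intrB -!pmulrn; field.
by rewrite ltr_wpDl ?divr_gt0 ?mulr_gt0 ?ltr0n.
Qed.

(** Replacing zeros by 1 preserves the reflection symmetry, so the exchange applies to the modified
    [quad], which can be divided by. On the range [j < n] the modification changes nothing, by
    positivity. *)
Lemma rhs_quad m n : (0 < m)%N -> (0 < n)%N ->
  \prod_(1 <= j < m)
     (nonzero_factor (m%:R * n%:R - binom2 m.+1%:Z + binom2 j%:Z)
      / nonzero_factor (d m n j))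
  = \prod_(1 <= j < n) quad m n (m%:Z - j%:Z)
    / \prod_(1 <= j < n) quad m n (n%:Z + m%:Z - 2 * j%:Z).
Proof.
move=> m0 n0; pose g t := nonzero_factor (quad m n t).
have g0 t : g t != 0.
  by rewrite /g /nonzero_factor; case: ifPn => // _; exact: oner_neq0.
have gE t : 0 < quad m n t -> quad m n t = g t.
  by rewrite /g /nonzero_factor => /lt0r_neq0/negPf ->.
have hg t : g (1 - t) = g t by rewrite /g quad_reflect.
have -> : \prod_(1 <= j < n) quad m n (m%:Z - j%:Z)
    = \prod_(1 <= j < n) g (m%:Z - j%:Z).
  by apply: eq_big_nat => j hj; apply/gE/quad_num_gt0.
have -> : \prod_(1 <= j < n) quad m n (n%:Z + m%:Z - 2 * j%:Z)
    = \prod_(1 <= j < n) g (n%:Z + m%:Z - 2 * j%:Z).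
  by apply: eq_big_nat => j /andP[_ hj]; apply/gE/quad_denom_gt0.
have -> : \prod_(1 <= j < m)
     (nonzero_factor (m%:R * n%:R - binom2 m.+1%:Z + binom2 j%:Z)
      / nonzero_factor (d m n j))
   = \prod_(1 <= j < m) g j%:Z
     / \prod_(1 <= j < m) g (n%:Z + m%:Z - 2 * j%:Z).
  rewrite -prodfV -big_split; apply: eq_big_nat => j /andP[j0 _] /=.
  by rewrite d_quad.
have p0 k (h : nat -> int) : \prod_(1 <= j < k) g (h j) != 0.
  by rewrite prodf_seq_neq0; apply/allP => j _; rewrite g0.
by apply/eqP; rewrite eqr_div ?p0 // prod_reflect_exchange // mulrC.
Qed.

(** * Truncation of the left-hand sum *)

Definition lhs_factor (m n j : nat) : rat :=
  - (m%:R - j%:R) * binom2 (n%:Z - 2 * j%:Z)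
  / (m%:R * binom2 n%:Z - (m%:R - j%:R) * binom2 (n%:Z - 2 * j%:Z)).

Lemma lhs_factor_half m n : lhs_factor m n n./2 = 0.
Proof.
rewrite /lhs_factor (_ : binom2 (n%:Z - 2 * n./2%:Z) = 0) ?mulr0 ?mul0r //.
have := odd_double_half n; rewrite /binom2; case: (odd n) => /= nE.
  have -> : n%:Z - 2 * n./2%:Z = 1 by lia.
  by rewrite subrr mulr0 mul0r.
have -> : n%:Z - 2 * n./2%:Z = 0 by lia.
by rewrite !mul0r.
Qed.

Lemma prod_lhs_factor_eq0 m n k i : (0 < k <= i)%N ->
  lhs_factor m n k = 0 -> \prod_(1 <= j < i.+1) lhs_factor m n j = 0.
Proof.
move=> /andP[k0 ki] hk; apply/eqP; rewrite prodf_seq_eq0; apply/hasP; exists k.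
  by rewrite mem_index_iota k0.
by rewrite hk eqxx.
Qed.

(** The factor at [j = n./2] vanishes through [binom2], the one at [j = m] through [m - j]; every
    summand containing either of them is zero. *)
Lemma sum_lhs_truncate m n : (0 < m)%N -> (2 <= n)%N ->
  \sum_(0 <= i < (minn m (n %/ 2)).+1) \prod_(1 <= j < i.+1) lhs_factor m n j
  = \sum_(0 <= i < n./2) \prod_(1 <= j < i.+1) lhs_factor m n j.
Proof.
move=> m0 n2; rewrite divn2; have h0 : (0 < n./2)%N by lia.
have [le_nm|lt_mn] := leqP n./2 m.
  rewrite big_nat_recr //= (@prod_lhs_factor_eq0 _ _ n./2) ?addr0 //.
    by rewrite h0 /=.
  exact: lhs_factor_half.
rewrite [RHS](@big_cat_nat _ _ _ m.+1) //=.
rewrite [X in _ = _ + X]big_nat_cond [X in _ = _ + X]big1 ?addr0 // => i.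
rewrite andbT => /andP[hi _]; apply: (@prod_lhs_factor_eq0 _ _ m).
  by rewrite m0 ltnW.
by rewrite /lhs_factor subrr oppr0 !mul0r.
Qed.

(** * Transfer to the algebraic numbers and conclusion *)

Lemma sum_lhs_closed_form m n : (0 < m)%N -> (2 <= n)%N ->
  (\sum_(0 <= i < n./2) \prod_(1 <= j < i.+1) lhs_factor m n j)
    * \prod_(1 <= j < n) quad m n (n%:Z + m%:Z - 2 * j%:Z)
  = m%:R * \prod_(1 <= j < n) quad m n (m%:Z - j%:Z).
Proof.
move=> m0 n2; apply: (fmorph_inj (ratr : {rmorphism rat -> algC})).
(* [s] and [p] are the sum and product required of [a] and [b], which are then the roots of
   [t ^ 2 - s t + p]; the square root of its discriminant may be irrational. *)
pose s : algC := m%:R + n%:R - 1 / 2.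
pose p : algC := n%:R * (n%:R - 1) / 4 + m%:R * (n%:R - 1 / 2).
pose w := sqrtC (s ^+ 2 - 4 * p).
have w2 : w ^+ 2 = s ^+ 2 - 4 * p by rewrite sqrtCK.
pose a := (s + w) / 2; pose b := (s - w) / 2.
have hs : a + b = s by rewrite /a /b; field.
have hp : a * b = p.
  transitivity ((s ^+ 2 - w ^+ 2) / 4); first by rewrite /a /b; field.
  by rewrite w2; field.
have ratr_den j : ratr (quad m n (n%:Z + m%:Z - 2 * j%:Z))
    = 2 * (j%:R - a) * (j%:R - b) :> algC.
  transitivity (2 * (j%:R ^+ 2 - (a + b) * j%:R + a * b)); last by ring.
  rewrite hs hp /s /p /quad /binom2 -natr1 !intrD !intrN !intrM -!pmulrn.
  by field.
have ratr_num j : ratr (quad m n (m%:Z - j%:Z))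
    = (2 * a - n%:R - j%:R) * (2 * b - n%:R - j%:R) / 2 :> algC.
  transitivity ((4 * (a * b) - 2 * (a + b) * (n%:R + j%:R)
                 + (n%:R + j%:R) ^+ 2) / 2); last by field.
  rewrite hs hp /s /p /quad /binom2 -natr1 !intrD !intrN -!pmulrn.
  by field.
(* Positivity over the rationals excludes zeros in [algC], where no order on [a] and [b] is at
   hand. *)
have den_neq0 j : (j < n)%N -> (j%:R - a) * (j%:R - b) != 0.
  move=> jn; have := quad_denom_gt0 m0 jn; rewrite -(ltr0q algC) ratr_den.
  by rewrite -mulrA => /lt0r_neq0; rewrite mulf_eq0 negb_or => /andP[].
rewrite !rmorphM !rmorph_prod /= rmorph_sum /= ratr_nat.
rewrite (eq_bigr _ (fun j _ => ratr_den j)) (eq_bigr _ (fun j _ => ratr_num j)).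
rewrite -(@sum_term_closed_form _ m%:R a b n) ?pnatr_eq0 -?lt0n //.
congr (_ * _); apply: eq_big_nat => i /andP[_ hi].
rewrite rmorph_prod big_add1 /sum_term; apply: eq_big_nat => j /andP[_ hj].
have hjn : (j.+1 < n)%N by lia.
have := den_neq0 _ hjn; rewrite mulf_eq0 negb_or => /andP[h1 h2].
have -> : lhs_factor m n j.+1
    = - (m%:R - j.+1%:R) * binom2 (n%:Z - 2 * j.+1%:Z)
      / (j.+1%:R * quad m n (n%:Z + m%:Z - 2 * j.+1%:Z)).
  by rewrite -denomE.
have ratr_top : ratr (- (m%:R - j.+1%:R) * binom2 (n%:Z - 2 * j.+1%:Z))
    = 2 * cubic m%:R n%:R j.+1%:R :> algC.
  by rewrite /cubic /binom2 intrB intrM -!pmulrn; field.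
rewrite fmorph_div /= ratr_top rmorphM /= ratr_den ratr_nat.
have n1 : j.+1%:R != 0 :> algC by rewrite pnatr_eq0.
set x := j.+1%:R in h1 h2 n1 *; set C := cubic _ _ _.
by clearbody C x; field; rewrite h1 h2 n1.
Qed.

Theorem theorem2 (m n : nat) (hm : (1 <= m)%N) (hn : (2 <= n)%N) :
  \sum_(0 <= i < (minn m (n %/ 2)).+1)
     \prod_(1 <= j < i.+1)
        (- (m%:R - j%:R) * binom2 (n%:Z - 2 * j%:Z)
         / (m%:R * binom2 n%:Z - (m%:R - j%:R) * binom2 (n%:Z - 2 * j%:Z)))
  = m%:R *
    \prod_(1 <= j < m)
       (nonzero_factor
          (m%:R * n%:R - binom2 (m.+1)%:Z + binom2 j%:Z)
        / nonzero_factor (d m n j)).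
Proof.
rewrite rhs_quad //; last exact: ltnW.
rewrite mulrA -sum_lhs_closed_form // -sum_lhs_truncate //.
rewrite mulfK // prodf_seq_neq0; apply/allP => j; rewrite mem_index_iota.
by case/andP=> _ jn; rewrite lt0r_neq0 ?quad_denom_gt0.
Qed.
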